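(* Let $\beta\in(1,+\infty)$. Then $\underline{\beta}_n$ is increasing to the limit $\beta$ and $\overline{\beta}_n$ is decreasing to the limit $\beta$ as $n\to\infty$.
   Context: For a real number $\beta>1$ let $T_\beta:[0,1]\to[0,1]$, $T_\beta x=\beta x-\lfloor\beta x\rfloor$, and for $x\in[0,1]$, $n\ge 1$ let $\varepsilon_n(x,\beta)=\lfloor\beta T_\beta^{n-1}x\rfloor$ (the $n$th digit of the $\beta$-expansion of $x$). For $n\ge1$ the $n$th cylinder of $\beta$ in the parameter space is $$I^P_n(\beta)=\{\beta'\in(1,+\infty):\varepsilon_1(1,\beta')=\varepsilon_1(1,\beta),\ldots,\varepsilon_n(1,\beta')=\varepsilon_n(1,\beta)\}.$$ It is an interval; $\underline{\beta}_n$ denotes its left endpoint (infimum) and $\overline{\beta}_n$ its right endpoint (supremum). ''Increasing'' and ''decreasing'' are meant in the weak sense (nondecreasing, nonincreasing). *)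

(* Defs.v *)
From HB Require Import structures.
From mathcomp Require Import all_boot all_order all_algebra.
From mathcomp Require Import all_classical all_reals all_analysis.
Set Implicit Arguments.
Unset Strict Implicit.
Unset Printing Implicit Defensive.
Import Order.TTheory GRing.Theory Num.Theory.
Import numFieldNormedType.Exports.
Local Open Scope classical_set_scope.
Local Open Scope ring_scope.

Definition betaT (R : realType) (beta x : R) : R :=
  beta * x - (Num.floor (beta * x))%:~R.

(* The digit eps_n(x, beta); digits are numbered from n = 1. *)
Definition digit (R : realType) (beta : R) (n : nat) (x : R) : int :=
  Num.floor (beta * iter n.-1 (betaT beta) x).

Definition cylinder (R : realType) (beta : R) (n : nat) : set R :=
  [set beta' : R | 1 < beta' /\
    forall k : nat, (1 <= k <= n)%N -> digit beta' k 1 = digit beta k 1].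

(* For beta > 1 and n >= 1 the cylinder contains beta and is included in
   [1, floor beta + 1], so [inf] and [sup] are its true infimum and supremum.
   For n = 0 it is ]1, +oo[, and [sup] only returns a default value. *)
Definition left_end (R : realType) (beta : R) (n : nat) : R :=
  inf (cylinder beta n).

Definition right_end (R : realType) (beta : R) (n : nat) : R :=
  sup (cylinder beta n).

(* Main.v *)
Require Import Defs.
From HB Require Import structures.
From mathcomp Require Import all_boot all_order all_algebra.
From mathcomp Require Import all_classical all_reals all_analysis.
From mathcomp Require Import ring.
Set Implicit Arguments.
Unset Strict Implicit.
Unset Printing Implicit Defensive.
Import Order.TTheory GRing.Theory Num.Theory.
Import numFieldNormedType.Exports.
Local Open Scope classical_set_scope.
Local Open Scope ring_scope.

(** Two bases that share their first [n] digits are close together. Write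
    [x_k] and [y_k] for the iterates of [1] under [betaT a] and [betaT b],
    with [0 <= a <= b]. As long as the digits agree, they cancel in the
    difference:

      y_{k+1} - x_{k+1} = b y_k - a x_k = b (y_k - x_k) + (b - a) x_k,

    so the gap [y_k - x_k] starts at [y_1 - x_1 = b - a] and is multiplied by
    at least [b] at each step. Both orbits stay in [0, 1], so the gap stays at
    most [1], and [(b - a) b ^ (n - 1) <= 1] ([gap_same_digits]).

    With [beta] in the role of [a] or of [b], this puts the [n]th cylinder
    within [beta ^ - (n - 1)] of [beta] ([cylinder_near]). Its two endpoints
    obey the same bound, which tends to [0]. They are monotone because the
    cylinders are nested and all contain [beta]. *)

Section Iterates.
Variable R : realType.
Implicit Types b x : R.

Lemma betaT_ge0 b x : 0 <= betaT b x.
Proof. by rewrite subr_ge0 floor_le. Qed.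

Lemma betaT_le1 b x : betaT b x <= 1.
Proof. by rewrite lerBlDl ltW// -intrD1 floorD1_gt. Qed.

Lemma iter_betaT_ge0 b n : 0 <= iter n (betaT b) 1.
Proof. by case: n => [|n]; [exact: ler01 | exact: betaT_ge0]. Qed.

Lemma iter_betaTS b n :
  iter n.+1 (betaT b) 1 = b * iter n (betaT b) 1 - (digit b n.+1 1)%:~R.
Proof. by []. Qed.

End Iterates.

Section Gap.
Variables (R : realType) (a b : R).
Hypotheses (a_ge0 : 0 <= a) (leab : a <= b).

(** At each step the common digit cancels, leaving [b] times the previous gap
    plus the nonnegative term [(b - a) * x], where [x] is in the orbit of [a]. *)
Lemma gap_expands n :
  (forall k, (1 <= k <= n.+1)%N -> digit a k 1 = digit b k 1) ->
  (b - a) * b ^+ n <= iter n.+1 (betaT b) 1 - iter n.+1 (betaT a) 1.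
Proof.
elim: n => [|n IHn] same.
  rewrite !iter_betaTS same// expr0 mulr1 -[iter 0 _ _]/1 !mulr1.
  by rewrite opprB addrA subrK.
have {}IHn : (b - a) * b ^+ n <= iter n.+1 (betaT b) 1 - iter n.+1 (betaT a) 1.
  by apply: IHn => k /andP[k1 kn]; apply: same; rewrite k1 ltnW.
rewrite (iter_betaTS b n.+1) (iter_betaTS a n.+1) same ?leqnn//.
set y := iter n.+1 (betaT b) 1 in IHn *.
set x := iter n.+1 (betaT a) 1 in IHn *.
have x_ge0 : 0 <= x by exact: iter_betaT_ge0.
have -> : b * y - (digit b n.+2 1)%:~R - (a * x - (digit b n.+2 1)%:~R)
        = (y - x) * b + (b - a) * x by ring.
rewrite exprSr mulrA -[leLHS]addr0 lerD//.
  by rewrite ler_wpM2r// (le_trans a_ge0).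
by rewrite mulr_ge0// subr_ge0.
Qed.

Lemma gap_same_digits n :
  (forall k, (1 <= k <= n.+1)%N -> digit a k 1 = digit b k 1) ->
  (b - a) * b ^+ n <= 1.
Proof.
move=> /gap_expands /le_trans; apply.
rewrite lerBlDr (le_trans (betaT_le1 _ _))// lerDl.
exact: iter_betaT_ge0.
Qed.

End Gap.

Section Cylinders.
Variables (R : realType) (beta : R).
Hypothesis beta_gt1 : 1 < beta.

Let beta_ge0 : 0 <= beta.
Proof. exact: le_trans ler01 (ltW beta_gt1). Qed.

Lemma cylinder_self n : cylinder beta n beta.
Proof. by split. Qed.

Lemma subset_cylinder m n :
  (m <= n)%N -> cylinder beta n `<=` cylinder beta m.
Proof.
move=> lemn x [x1 same]; split=> // k /andP[k1 km].
by apply: same; rewrite k1 (leq_trans km).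
Qed.

(** The larger of the two bases controls the expansion in [gap_same_digits],
    and it is at least [beta] on either side. The radius is [beta ^ - (n - 1)],
    written so as to be a constant times a geometric sequence in [n]. *)
Lemma cylinder_near n x : (0 < n)%N -> cylinder beta n x ->
  beta - beta * beta^-1 ^+ n <= x <= beta + beta * beta^-1 ^+ n.
Proof.
case: n => // n _ [x_gt1 same].
have -> : beta * beta^-1 ^+ n.+1 = (beta ^+ n)^-1.
  by rewrite exprS mulrA divff ?mul1r ?exprVn// gt_eqF// (lt_trans ltr01).
have pow_gt0 : 0 < beta ^+ n by rewrite exprn_gt0// (lt_trans ltr01).
have [lexb|ltbx] := leP x beta.
  have := gap_same_digits (le_trans ler01 (ltW x_gt1)) lexb same.
  rewrite -ler_pdivlMr// div1r => near.
  by rewrite lerBlDr addrC -lerBlDr near (le_trans lexb)// lerDl invr_ge0 ltW.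
have near : (x - beta) * beta ^+ n <= 1.
  apply: le_trans (gap_same_digits beta_ge0 (ltW ltbx)
    (fun k kn => esym (same k kn))).
  rewrite ler_wpM2l ?subr_ge0 ?(ltW ltbx)//.
  by apply: lerXn2r (ltW ltbx); rewrite nnegrE ?(le_trans beta_ge0 (ltW ltbx)).
move: near; rewrite -ler_pdivlMr// div1r lerBlDl => ->; rewrite andbT.
by rewrite lerBlDr (le_trans (ltW ltbx))// lerDl invr_ge0 ltW.
Qed.

Lemma has_lbound_cylinder n : has_lbound (cylinder beta n).
Proof. by exists 1 => x [/ltW]. Qed.

Lemma has_ubound_cylinder n : (0 < n)%N -> has_ubound (cylinder beta n).
Proof.
move=> n0; exists (beta + beta * beta^-1 ^+ n) => x.
by move=> /(cylinder_near n0)/andP[].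
Qed.

Lemma left_end_le n : left_end beta n <= beta.
Proof. by apply: ge_inf; [exact: has_lbound_cylinder|exact: cylinder_self]. Qed.

Lemma right_end_ge n : (0 < n)%N -> beta <= right_end beta n.
Proof.
by move=> n0; apply: ub_le_sup; [exact: has_ubound_cylinder|exact: cylinder_self].
Qed.

Lemma left_end_nondecreasing m n : (m <= n)%N -> left_end beta m <= left_end beta n.
Proof.
move=> lemn; apply: lb_le_inf; first by exists beta; exact: cylinder_self.
move=> x /(subset_cylinder lemn) ?; apply: ge_inf => //.
exact: has_lbound_cylinder.
Qed.

(** The index [0] is excluded because its cylinder is unbounded above, so that
    [sup] is only a default value there. *)
Lemma right_end_nonincreasing m n : (1 <= m <= n)%N ->
  right_end beta n <= right_end beta m.
Proof.
move=> /andP[m0 lemn]; apply: ge_sup; first by exists beta; exact: cylinder_self.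
move=> x /(subset_cylinder lemn) ?; apply: ub_le_sup => //.
exact: has_ubound_cylinder.
Qed.

Lemma cvg_radius : beta * beta^-1 ^+ n @[n --> \oo] --> 0.
Proof.
rewrite -(mulr0 beta); apply: cvgMr; apply: cvg_expr.
by rewrite ger0_norm ?invr_ge0// invf_lt1// (lt_trans ltr01).
Qed.

Lemma cvg_left_end : left_end beta n @[n --> \oo] --> beta.
Proof.
apply: (@squeeze_cvgr _ _ _ _ (fun n => beta - beta * beta^-1 ^+ n)
  (fun=> beta)); last exact: cvg_cst.
- near=> n; rewrite left_end_le andbT.
  apply: lb_le_inf; first by exists beta; exact: cylinder_self.
  by move=> x /cylinder_near -/(_ ltac:(near: n; exact: nbhs_infty_gt))/andP[].
- by rewrite -[X in _ --> X]subr0; apply: cvgB cvg_radius; exact: cvg_cst.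
Unshelve. all: by end_near. Qed.

Lemma cvg_right_end : right_end beta n @[n --> \oo] --> beta.
Proof.
apply: (@squeeze_cvgr _ _ _ _ (fun=> beta)
  (fun n => beta + beta * beta^-1 ^+ n)); first last.
- by rewrite -[X in _ --> X]addr0; apply: cvgD cvg_radius; exact: cvg_cst.
- exact: cvg_cst.
near=> n.
have n0 : (0 < n)%N by near: n; exact: nbhs_infty_gt.
rewrite right_end_ge//=; apply: ge_sup; first by exists beta; exact: cylinder_self.
by move=> x /(cylinder_near n0)/andP[].
Unshelve. all: by end_near. Qed.

End Cylinders.

Theorem theorem1p1 (R : realType) (beta : R) (hbeta : 1 < beta) :
  ((forall m n : nat, (1 <= m <= n)%N -> left_end beta m <= left_end beta n) /\
   left_end beta n @[n --> \oo] --> beta) /\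
  ((forall m n : nat, (1 <= m <= n)%N -> right_end beta n <= right_end beta m) /\
   right_end beta n @[n --> \oo] --> beta).
Proof.
split; split.
- by move=> m n /andP[_]; exact: left_end_nondecreasing.
- exact: cvg_left_end.
- by move=> m n; exact: right_end_nonincreasing.
- exact: cvg_right_end.
Qed.
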